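(* Let $b$ be a geometric structure on a manifold $M$, and $\{\cdot,\cdot\}_b$ the associated $b$-bracket. Let $F\in\mathcal{C}^{\infty}(M,\mathbb{R})$ be a smooth function, and $\nabla^{L}_{b}F,\nabla^{R}_{b}F\in\mathfrak{X}(M)$ the corresponding gradients. If $\Phi^{L}_{t}$ and $\Phi^{R}_{t}$ denote the flows of $\nabla^{L}_{b}F$ and $\nabla^{R}_{b}F$ respectively, then for any $f\in\mathcal{C}^{\infty}(M,\mathbb{R})$ $$\dfrac{\mathrm{d}}{\mathrm{d}t}(\Phi^{L}_{t})^{\star}f=(\Phi^{L}_{t})^{\star}\{f,F\}_b,\qquad \dfrac{\mathrm{d}}{\mathrm{d}t}(\Phi^{R}_{t})^{\star}f=(\Phi^{R}_{t})^{\star}\{F,f\}_b,$$ where $(\Phi^{L}_{t})^{\star}g:=g\circ\Phi^{L}_{t}$ and $(\Phi^{R}_{t})^{\star}g:=g\circ\Phi^{R}_{t}$ for any $g\in\mathcal{C}^{\infty}(M,\mathbb{R})$.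
   Context: All manifolds are connected, Hausdorff, paracompact and smooth; all maps are smooth. A geometric structure on $M$ is a non-degenerate $(0,2)$-tensor field $b:\mathfrak{X}(M)\times\mathfrak{X}(M)\to\mathcal{C}^{\infty}(M,\mathbb{R})$ (no symmetry is assumed). For a smooth function $F$, the left-gradient $\nabla^{L}_{b}F$ and the right-gradient $\nabla^{R}_{b}F$ are the vector fields uniquely defined by $b(\nabla^{L}_{b}F,X)=\mathrm{d}F\cdot X$ and $b(X,\nabla^{R}_{b}F)=\mathrm{d}F\cdot X$ for all $X\in\mathfrak{X}(M)$. The $b$-bracket is $\{F,G\}_b:=b(\nabla_{b}^{L}F,\nabla_{b}^{L}G)=b(\nabla_{b}^{R}F,\nabla_{b}^{R}G)$ (the two expressions agree). Flows are the (possibly only local) flows of the vector fields, and the identities are understood at all points and times where the flow is defined. *)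

(* Defs.v *)
From HB Require Import structures.
From mathcomp Require Import all_boot all_order all_algebra.
From mathcomp Require Import all_classical all_reals all_analysis.

Set Implicit Arguments.
Unset Strict Implicit.
Unset Printing Implicit Defensive.

Import Order.TTheory GRing.Theory Num.Theory.
Import numFieldNormedType.Exports.

Local Open Scope classical_set_scope.
Local Open Scope ring_scope.

(* Meaningful for open U only: continuity and differentiability are those of
   the ambient space at the points of U, and f may be arbitrary outside U. *)
Fixpoint Ck_on (R : realType) (V W : normedModType R) (k : nat)
    (U : set V) (f : V -> W) : Prop :=
  if k is k'.+1 then
    (forall x, U x -> differentiable f x) /\
    (forall v, Ck_on k' U (fun x => 'd f x v))
  else forall x, U x -> {for x, continuous f}.

Definition smooth_on (R : realType) (V W : normedModType R)
    (U : set V) (f : V -> W) : Prop :=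
  forall k, Ck_on k U f.

Definition locally_finite (M : topologicalType) (D : set (set M)) : Prop :=
  forall p : M, exists2 N, nbhs p N & finite_set [set A | D A /\ A `&` N !=set0].

Definition paracompact (M : topologicalType) : Prop :=
  forall C : set (set M),
    C `<=` open -> \bigcup_(A in C) A = [set: M] ->
    exists D : set (set M),
      [/\ D `<=` open, \bigcup_(B in D) B = [set: M],
          forall B, D B -> exists2 A, C A & B `<=` A
        & locally_finite D].

(* [cmap] is a homeomorphism from [cdom] onto its open image, with inverse
   [cinv]; the values of [cmap] and [cinv] elsewhere are irrelevant. *)
Record chart (R : realType) (n : nat) (M : topologicalType) := Chart {
  cdom : set M;
  cmap : M -> 'rV[R]_n;
  cinv : 'rV[R]_n -> M;
  cdom_open : open cdom;
  cimg_open : open (cmap @` cdom);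
  cmapK : forall p, cdom p -> cinv (cmap p) = p;
  cmap_continuous : forall p, cdom p -> {for p, continuous cmap};
  cinv_continuous : forall x, (cmap @` cdom) x -> {for x, continuous cinv}
}.

Definition cimg (R : realType) (n : nat) (M : topologicalType)
  (c : chart R n M) : set 'rV[R]_n := cmap c @` cdom c.

Definition transition (R : realType) (n : nat) (M : topologicalType)
  (c d : chart R n M) : 'rV[R]_n -> 'rV[R]_n := cmap d \o cinv c.

(* The smooth structure is given by any smooth atlas, not necessarily the
   maximal one. *)
Record manifold (R : realType) (n : nat) := Manifold {
  carrier :> topologicalType;
  atlas_index : Type;
  atlas : atlas_index -> chart R n carrier;
  atlas_cover : forall p : carrier, exists i, cdom (atlas i) p;
  atlas_smooth : forall i j,
    smooth_on (cmap (atlas i) @` (cdom (atlas i) `&` cdom (atlas j)))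
              (transition (atlas i) (atlas j));
  manifold_hausdorff : hausdorff_space carrier;
  manifold_connected : connected [set: carrier];
  manifold_paracompact : paracompact carrier
}.
Arguments atlas {R n} _ _.

Section Fields.
Variables (R : realType) (n : nat) (M : manifold R n).
Local Notation I := (atlas_index M).

Definition chart_at (p : M) : I := projT1 (cid (atlas_cover p)).

Lemma chart_atP (p : M) : cdom (atlas M (chart_at p)) p.
Proof. exact: projT2 (cid (atlas_cover p)). Qed.

(* The Jacobian of the change of coordinates from chart i to chart j at p, in
   the row-vector convention: 'd (transition i j) v = v *m J. *)
Definition trans_jacobian (i j : I) (p : M) : 'M[R]_n :=
  jacobian (transition (atlas M i) (atlas M j)) (cmap (atlas M i) p).

Record cinfty := Cinfty {
  cfun :> M -> R;
  cfun_smooth : forall i,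
    smooth_on (cimg (atlas M i)) (cfun \o cinv (atlas M i) : 'rV[R]_n -> R^o)
}.

(* A vector field is given by its component row vector in each chart i, which
   is meaningful at the points of the domain of i only. *)
Record vfield := Vfield {
  vcomp : I -> M -> 'rV[R]_n;
  vcomp_change : forall i j p, cdom (atlas M i) p -> cdom (atlas M j) p ->
    vcomp j p = vcomp i p *m trans_jacobian i j p;
  vcomp_smooth : forall i,
    smooth_on (cimg (atlas M i)) (vcomp i \o cinv (atlas M i))
}.

Definition bilin (B : 'M[R]_n) (v w : 'rV[R]_n) : R := (v *m B *m w^T) 0 0.

(* A (0,2)-tensor field is given in chart i by the matrix of the values
   b(d/dx_k, d/dx_l); no symmetry is assumed. Each of the two non-degeneracy
   fields implies the other one. *)
Record geom_struct := GeomStruct {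
  bcomp : I -> M -> 'M[R]_n;
  bcomp_change : forall i j p, cdom (atlas M i) p -> cdom (atlas M j) p ->
    bcomp i p = trans_jacobian i j p *m bcomp j p *m (trans_jacobian i j p)^T;
  bcomp_smooth : forall i,
    smooth_on (cimg (atlas M i)) (bcomp i \o cinv (atlas M i));
  b_nondegL : forall i p, cdom (atlas M i) p ->
    forall v, (forall w, bilin (bcomp i p) v w = 0) -> v = 0;
  b_nondegR : forall i p, cdom (atlas M i) p ->
    forall w, (forall v, bilin (bcomp i p) v w = 0) -> w = 0
}.

Definition beval (b : geom_struct) (X Y : vfield) (p : M) : R :=
  let i := chart_at p in bilin (bcomp b i p) (vcomp X i p) (vcomp Y i p).

Lemma bevalE (b : geom_struct) (X Y : vfield) i p : cdom (atlas M i) p ->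
  beval b X Y p = bilin (bcomp b i p) (vcomp X i p) (vcomp Y i p).
Proof.
move=> pi; have pj := chart_atP p.
rewrite /beval /= /bilin (bcomp_change b pj pi).
rewrite (vcomp_change X pj pi) (vcomp_change Y pj pi).
by rewrite trmx_mul !mulmxA.
Qed.

Lemma diff_compE (U V W : normedModType R) (g : U -> V) (h : V -> W) x u :
  differentiable g x -> differentiable h (g x) ->
  'd h (g x) ('d g x u) = 'd (h \o g) x u.
Proof. by move=> Dg Dh; rewrite [in RHS]diff_comp. Qed.

Definition dfun_in (F : cinfty) (i : I) (X : vfield) (p : M) : R :=
  'd (F \o cinv (atlas M i) : 'rV[R]_n -> R^o) (cmap (atlas M i) p)
     (vcomp X i p).

Definition dfun (F : cinfty) (X : vfield) (p : M) : R :=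
  dfun_in F (chart_at p) X p.

Lemma dfunE (F : cinfty) (X : vfield) i p : cdom (atlas M i) p ->
  dfun F X p = dfun_in F i X p.
Proof.
move=> pi; have pj := chart_atP p; rewrite /dfun; set j := chart_at p in pj *.
rewrite /dfun_in (vcomp_change X pj pi) /trans_jacobian.
set x := cmap (atlas M j) p.
have Dt : differentiable (transition (atlas M j) (atlas M i)) x.
  by apply: (atlas_smooth j i 1).1; exists p.
have Tx : transition (atlas M j) (atlas M i) x = cmap (atlas M i) p.
  by rewrite /transition /= cmapK.
have DF : differentiable (F \o cinv (atlas M i) : 'rV[R]_n -> R^o)
    (transition (atlas M j) (atlas M i) x).
  by rewrite Tx; apply: (cfun_smooth F i 1).1; exists p.
rewrite /jacobian mul_rV_lin1 -Tx; apply: esym.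
apply: (eq_trans (diff_compE (vcomp X j p) Dt DF) _).
have DTF := differentiable_comp Dt DF.
have DFj : differentiable (F \o cinv (atlas M j) : 'rV[R]_n -> R^o) x.
  by apply: (cfun_smooth F j 1).1; exists p.
rewrite -(deriveE _ DTF) -(deriveE _ DFj).
apply: near_eq_derive.
have xj : cimg (atlas M j) x by exists p.
have nj : nbhs x (cinv (atlas M j) @^-1` cdom (atlas M i)).
  apply: cinv_continuous => //; rewrite cmapK //.
  by apply: open_nbhs_nbhs; split => //; exact: cdom_open.
apply: filterS nj => y /= yi.
by rewrite /transition /= cmapK.
Qed.

Lemma Ck_on_cst (V W : normedModType R) k (U : set V) (w : W) :
  Ck_on k U (cst w).
Proof.
elim: k w => [|k IH] w /=; first by move=> x _; exact: cst_continuous.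
split=> [x _|v]; first exact: differentiable_cst.
rewrite (_ : (fun x => _) = cst 0); first exact: IH.
by apply/funext => x; rewrite diff_cst.
Qed.

Lemma vzero_change i j p : cdom (atlas M i) p -> cdom (atlas M j) p ->
  0 = 0 *m trans_jacobian i j p :> 'rV[R]_n.
Proof. by move=> _ _; rewrite mul0mx. Qed.

Definition vzero : vfield :=
  @Vfield (fun _ _ => 0) vzero_change (fun i k => Ck_on_cst k _ 0).

(* A vector field satisfying P; the value vzero is used only if there is none,
   which does not happen for the gradients of a non-degenerate b. *)
Definition the_vfield (P : vfield -> Prop) : vfield :=
  if pselect (exists X, P X) is left h then projT1 (cid h) else vzero.

Definition is_gradL (b : geom_struct) (F : cinfty) (G : vfield) : Prop :=
  forall X p, beval b G X p = dfun F X p.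

Definition is_gradR (b : geom_struct) (F : cinfty) (G : vfield) : Prop :=
  forall X p, beval b X G p = dfun F X p.

Definition gradL (b : geom_struct) (F : cinfty) : vfield :=
  the_vfield (is_gradL b F).

Definition gradR (b : geom_struct) (F : cinfty) : vfield :=
  the_vfield (is_gradR b F).

(* Right gradients would give the same function, by beval_gradLR below. *)
Definition bracket (b : geom_struct) (F G : cinfty) : M -> R :=
  beval b (gradL b F) (gradL b G).

Lemma beval_gradLR (b : geom_struct) (F G : cinfty) (LF LG RF RG : vfield) p :
  is_gradL b F LF -> is_gradL b G LG -> is_gradR b F RF -> is_gradR b G RG ->
  beval b LF LG p = beval b RF RG p.
Proof.
move=> hLF hLG hRF hRG.
by rewrite (hLF LG p) -(hRF LG p) (hLG RF p) -(hRG RF p).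
Qed.

(* c is differentiable at t, with c'(t) = X (c t). *)
Definition integral_at (X : vfield) (c : R -> M) (t : R) : Prop :=
  {for t, continuous c} /\
  forall i, cdom (atlas M i) (c t) ->
    is_derive t (1 : R) (cmap (atlas M i) \o c) (vcomp X i (c t)).

(* The flow fl_map t p is meaningful for (t, p) in the open set fl_dom; each
   time slice of fl_dom over a point is empty or an interval around 0, so
   that both the maximal flow and its restrictions are covered. *)
Record flow (X : vfield) := Flow {
  fl_dom : set (R * M);
  fl_map : R -> M -> M;
  fl_open : open fl_dom;
  fl_interval : forall p, is_interval [set t | fl_dom (t, p)];
  fl_dom0 : forall t p, fl_dom (t, p) -> fl_dom (0, p);
  fl_map0 : forall p, fl_dom (0, p) -> fl_map 0 p = p;
  fl_integral : forall t p, fl_dom (t, p) -> integral_at X (fl_map^~ p) t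
}.

Definition pullback (phi : M -> M) (g : M -> R) : M -> R := g \o phi.

End Fields.

(* Main.v *)
Require Import Defs.
From HB Require Import structures.
From mathcomp Require Import all_boot all_order all_algebra.
From mathcomp Require Import all_classical all_reals all_analysis.
Import Order.TTheory GRing.Theory Num.Theory.
Import numFieldNormedType.Exports.
Local Open Scope classical_set_scope.
Local Open Scope ring_scope.

(** Both formulas are the chain rule along an integral curve, followed by the
defining property of a gradient. If c is an integral curve of a vector field X,
reading f and c in one chart near c t gives (f o c)'(t) = (df . X)(c t)
([integral_at_comp]). For X the left gradient of F,
df . X = b(grad^L f, X) = {f, F}_b; for X the right gradient of F,
df . X = b(X, grad^R f), which is {F, f}_b in its expression by right gradients
([bracket_gradL], [bracket_gradR]).

The substance is that the gradients exist: [gradL] and [gradR] pick a vector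
field having the gradient property, so this property has to be realised by a
smooth field. In a chart where b has matrix B and dF has row g, the equation
v B w^T = g w^T for all w has the unique solution v = g B^-1. These local
solutions agree on overlaps because g is covariant ([dcomp_change]), B is
bi-covariant, and the Jacobians are invertible ([gradL_comp_change]). They are
smooth because smooth functions on an open set are closed under products,
determinants and inverses of invertible matrices, by Cramer's rule
([Ck_on_invmx]). Right gradients for b are left gradients for the transposed
tensor field ([is_gradR_opp]). *)

Set Implicit Arguments.
Unset Strict Implicit.
Unset Printing Implicit Defensive.

(** * Calculus of k times differentiable maps on an open set *)

Section CkCalculus.
Variables (R : realType) (V : normedModType R).

(** Differentiability and the differential are local: the first-order expansion
of f at x is also one of g, and the differential is the only linear map giving
such an expansion. *)
Lemma near_eq_diff (W : normedModType R) (f g : V -> W) (x : V) :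
  (\near x, f x = g x) -> differentiable f x ->
  differentiable g x /\ 'd g x = 'd f x :> (V -> W).
Proof.
move=> fg df.
have fg0 : \forall h \near 0, f (h + x) = g (h + x).
  by move: (fg); rewrite (near_shift 0 x) /= subr0.
have E : g \o shift x = cst (g x) + 'd f x +o_ 0 id.
  have := diff_locally df; rewrite (nbhs_singleton fg) => /eqaddoP H.
  apply/eqaddoP => e e0; near=> h.
  have -> : (g \o shift x - (cst (g x) + 'd f x)) h =
            (f \o shift x - (cst (g x) + 'd f x)) h.
    by rewrite !fctE /=; congr (_ - _); apply/esym; near: h.
  by near: h; exact: H.
have D := diff_unique (diff_continuous df) E.
split=> //; apply/diff_locallyP; rewrite D; split=> //.
exact: diff_continuous.
Unshelve. all: by end_near. Qed.

Variables (U : set V).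
Hypothesis oU : open U.

(** The differential of a composite, product or inverse is known at the points
of U only, so each induction on k below replaces the iterated differential by a
function that agrees with it on U. Openness of U makes this legitimate. *)
Lemma Ck_on_ext (W : normedModType R) k (f g : V -> W) :
  {in U, f =1 g} -> Ck_on k U f -> Ck_on k U g.
Proof.
have nU x : U x -> nbhs x U by move=> Ux; exact: open_nbhs_nbhs.
elim: k f g => [|k IH] f g fg /=.
  move=> cf x Ux.
  have nfg : \near x, f x = g x.
    by apply: filterS (nU _ Ux) => y Uy; apply: fg; rewrite inE.
  have : g @ x --> f x by apply: cvg_trans (cf x Ux); exact: near_eq_cvg.
  by rewrite (nbhs_singleton nfg).
case=> df dCk.
have D x : U x -> differentiable g x /\ 'd g x = 'd f x :> (V -> W).
  move=> Ux; apply: near_eq_diff (df x Ux).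
  by apply: filterS (nU _ Ux) => y Uy; apply: fg; rewrite inE.
split=> [x /D[]//|v]; apply: IH (dCk v) => x.
by rewrite inE => /D[_ ->].
Qed.

Lemma Ck_on_pred (W : normedModType R) k (f : V -> W) :
  Ck_on k.+1 U f -> Ck_on k U f.
Proof.
elim: k f => [|k IH] f [df dCk]; last by split=> // v; apply: IH.
by move=> x Ux; apply: differentiable_continuous; exact: df.
Qed.

Lemma Ck_on_linear (W W' : normedModType R) (L : W -> W') k (f : V -> W) :
  linear L -> continuous L -> Ck_on k U f -> Ck_on k U (L \o f).
Proof.
move=> linL cL.
pose LM := GRing.isLinear.Build _ _ _ _ _ linL.
pose L' : {linear W -> W'} := HB.pack L LM.
elim: k f => [|k IH] f.
  by move=> cf x Ux; apply: continuous_comp; [exact: cf|exact: cL].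
case=> df dCk.
have dL y : differentiable L y by exact: (@linear_differentiable _ _ _ L').
split=> [x Ux|v]; first by apply: differentiable_comp => //; exact: df.
apply: Ck_on_ext (IH _ (dCk v)) => x; rewrite inE => Ux.
rewrite diff_comp//; last exact: df.
by rewrite [in RHS](@diff_lin _ _ _ L').
Qed.

Lemma Ck_onD (W : normedModType R) k (f g : V -> W) :
  Ck_on k U f -> Ck_on k U g -> Ck_on k U (f \+ g).
Proof.
elim: k f g => [|k IH] f g.
  by move=> cf cg x Ux; apply: continuousD; [exact: cf|exact: cg].
move=> [df dfC] [dg dgC]; split=> [x Ux|v].
  by apply: differentiableD; [exact: df|exact: dg].
apply: Ck_on_ext (IH _ _ (dfC v) (dgC v)) => x; rewrite inE => Ux.
by rewrite [RHS](congr1 (fun h => h v) (diffD (df x Ux) (dg x Ux))).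
Qed.

Lemma Ck_on_sum (W : normedModType R) k (I : Type) (r : seq I) (P : pred I)
  (f : I -> V -> W) :
  (forall i, P i -> Ck_on k U (f i)) ->
  Ck_on k U (fun x => \sum_(i <- r | P i) f i x).
Proof.
move=> Cf; elim: r => [|i r IH].
  by under eq_fun do rewrite big_nil; exact: Ck_on_cst.
have [Pi|/negbTE Pi] := boolP (P i); last first.
  by under eq_fun do rewrite big_cons Pi.
under eq_fun do rewrite big_cons Pi.
by apply: Ck_onD => //; exact: Cf.
Qed.

(** By the Leibniz rule the differential of f g involves f and g themselves
along with their differentials; [Ck_on_pred] lowers the order of the former. *)
Lemma Ck_onM k (f g : V -> R^o) :
  Ck_on k U f -> Ck_on k U g -> Ck_on k U (f \* g : V -> R^o).
Proof.
elim: k f g => [|k IH] f g.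
  by move=> cf cg x Ux; apply: continuousM; [exact: cf|exact: cg].
move=> Cf Cg; have [df dfC] := Cf; have [dg dgC] := Cg.
split=> [x Ux|v]; first by apply: differentiableM; [exact: df|exact: dg].
have := Ck_onD (IH _ _ (Ck_on_pred Cf) (dgC v)) (IH _ _ (Ck_on_pred Cg) (dfC v)).
apply: Ck_on_ext => x; rewrite inE => Ux.
by rewrite [RHS](congr1 (fun h => h v) (diffM (df x Ux) (dg x Ux))).
Qed.

Lemma Ck_on_prod k (I : Type) (r : seq I) (P : pred I) (f : I -> V -> R^o) :
  (forall i, P i -> Ck_on k U (f i)) ->
  Ck_on k U (fun x => \prod_(i <- r | P i) f i x : R^o).
Proof.
move=> Cf; elim: r => [|i r IH].
  by under eq_fun do rewrite big_nil; exact: Ck_on_cst.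
have [Pi|/negbTE Pi] := boolP (P i); last first.
  by under eq_fun do rewrite big_cons Pi.
under eq_fun do rewrite big_cons Pi.
by apply: Ck_onM => //; exact: Cf.
Qed.

(** The differential of 1/f is - (1/f)^2 df, in which 1/f occurs at the lower
order given by the induction hypothesis. *)
Lemma Ck_onV k (f : V -> R^o) :
  (forall x, U x -> f x != 0) -> Ck_on k U f ->
  Ck_on k U (fun x => (f x)^-1 : R^o).
Proof.
move=> f0; elim: k => [|k IH].
  by move=> cf x Ux; apply: continuousV; [exact: f0|exact: cf].
move=> Cf; have [df dfC] := Cf.
split=> [x Ux|v]; first by apply: differentiableV; [exact: df|exact: f0].
have CV := IH (Ck_on_pred Cf).
have := Ck_onM (Ck_on_cst k U (-1 : R^o)) (Ck_onM (Ck_onM CV CV) (dfC v)).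
apply: Ck_on_ext => x; rewrite inE => Ux.
rewrite [RHS](congr1 (fun h => h v) (diffV (df x Ux) (f0 x Ux))) /=.
by rewrite mulN1r -expr2 exprVn [in RHS]/GRing.scale/= mulNr.
Qed.

Lemma Ck_on_entry k m n (A : V -> 'M[R]_(m, n)) i j :
  Ck_on k U A -> Ck_on k U (fun x => A x i j : R^o).
Proof.
apply: (@Ck_on_linear _ R^o (fun B : 'M[R]_(m, n) => B i j)).
  by move=> a B C; rewrite !mxE.
exact: coord_continuous.
Qed.

(** A matrix is the sum of its entries times the elementary matrices, and
a |-> a E_ij is linear and continuous. *)
Lemma Ck_on_mx k m n (A : V -> 'M[R]_(m, n)) :
  (forall i j, Ck_on k U (fun x => A x i j : R^o)) -> Ck_on k U A.
Proof.
move=> CA.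
rewrite (_ : A = fun x => \sum_i \sum_j A x i j *: delta_mx i j); last first.
  by apply/funext => x; rewrite -matrix_sum_delta.
apply: Ck_on_sum => i _; apply: Ck_on_sum => j _.
apply: (@Ck_on_linear R^o _ (fun a => a *: delta_mx i j)) (CA i j).
  by move=> a u v; rewrite scalerDl scalerA.
exact: scalel_continuous.
Qed.

Lemma Ck_on_mulmx k m n p (A : V -> 'M[R]_(m, n)) (B : V -> 'M[R]_(n, p)) :
  Ck_on k U A -> Ck_on k U B -> Ck_on k U (fun x => A x *m B x).
Proof.
move=> CA CB; apply: Ck_on_mx => i j; under eq_fun do rewrite mxE.
by apply: Ck_on_sum => l _; apply: Ck_onM; exact: Ck_on_entry.
Qed.

Lemma Ck_on_trmx k m n (A : V -> 'M[R]_(m, n)) :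
  Ck_on k U A -> Ck_on k U (fun x => (A x)^T).
Proof.
move=> CA; apply: Ck_on_mx => i j; under eq_fun do rewrite mxE.
exact: Ck_on_entry.
Qed.

Lemma Ck_on_det k n (A : V -> 'M[R]_n) :
  Ck_on k U A -> Ck_on k U (fun x => \det (A x) : R^o).
Proof.
move=> CA; apply: Ck_on_sum => s _.
apply: Ck_onM; first exact: Ck_on_cst.
by apply: Ck_on_prod => i _; exact: Ck_on_entry.
Qed.

Lemma Ck_on_adj k n (A : V -> 'M[R]_n) :
  Ck_on k U A -> Ck_on k U (fun x => \adj (A x)).
Proof.
move=> CA; apply: Ck_on_mx => i j; under eq_fun do rewrite mxE.
apply: Ck_onM; first exact: Ck_on_cst.
apply: Ck_on_det; apply: Ck_on_mx => a c; under eq_fun do rewrite !mxE.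
exact: Ck_on_entry.
Qed.

(** Cramer's rule: on U the inverse is the adjugate divided by the
determinant. *)
Lemma Ck_on_invmx k n (A : V -> 'M[R]_n) :
  (forall x, U x -> A x \in unitmx) -> Ck_on k U A ->
  Ck_on k U (fun x => invmx (A x)).
Proof.
move=> uA CA.
apply: (@Ck_on_ext _ k (fun x => (\det (A x))^-1 *: \adj (A x))).
  by move=> x; rewrite inE => Ux; rewrite /invmx uA.
apply: Ck_on_mx => i j; under eq_fun do rewrite mxE.
apply: Ck_onM; last exact/Ck_on_entry/Ck_on_adj.
by apply: Ck_onV; [move=> x /uA; rewrite unitmxE unitfE|exact: Ck_on_det].
Qed.

End CkCalculus.

(** * Differentials and gradients in charts *)

Section Gradients.
Variables (R : realType) (n : nat) (M : manifold R n).
Implicit Types (b : geom_struct M) (F : cinfty M) (X : vfield M).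
Local Notation chart i := (atlas M i).

Lemma cimg_open_atlas i : open (cimg (chart i)).
Proof. exact: cimg_open. Qed.

Lemma differentiable_cfun F i p : cdom (chart i) p ->
  differentiable (F \o cinv (chart i) : 'rV[R]_n -> R^o) (cmap (chart i) p).
Proof. by move=> pi; apply: (cfun_smooth F i 1).1; exists p. Qed.

(** The row of partial derivatives of F in chart i: the components of dF. *)
Definition dcomp F i (p : M) : 'rV[R]_n :=
  \row_k 'd (F \o cinv (chart i) : 'rV[R]_n -> R^o) (cmap (chart i) p)
            (delta_mx 0 k).

Lemma dcompE F i p w :
  'd (F \o cinv (chart i) : 'rV[R]_n -> R^o) (cmap (chart i) p) w =
  (w *m (dcomp F i p)^T) 0 0.
Proof.
rewrite {1}(row_sum_delta w) linear_sum mxE.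
by apply: eq_bigr => k _; rewrite linearZ !mxE.
Qed.

(** F o cinv_i and (F o cinv_j) o (transition from i to j) agree near the image
of p only, whence the use of [near_eq_diff] before the chain rule. It is stated
for an arbitrary w, which need not be the value at p of a vector field. *)
Lemma diff_change F i j p w : cdom (chart i) p -> cdom (chart j) p ->
  'd (F \o cinv (chart i) : 'rV[R]_n -> R^o) (cmap (chart i) p) w =
  'd (F \o cinv (chart j) : 'rV[R]_n -> R^o) (cmap (chart j) p)
     (w *m trans_jacobian i j p).
Proof.
move=> pi pj; set x := cmap (chart i) p.
have Dt : differentiable (transition (chart i) (chart j)) x.
  by apply: (atlas_smooth i j 1).1; exists p.
have Tx : transition (chart i) (chart j) x = cmap (chart j) p.
  by rewrite /transition /= cmapK.
have DF := differentiable_cfun F pj.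
rewrite /trans_jacobian /jacobian mul_rV_lin1 -/x; rewrite -Tx in DF *.
apply: (eq_trans _ (esym (diff_compE w Dt DF))).
have nj : nbhs x (cinv (chart i) @^-1` cdom (chart j)).
  apply: cinv_continuous; first by exists p.
  by rewrite /x cmapK //; apply: open_nbhs_nbhs; split => //; exact: cdom_open.
have FE : \near x, (F \o cinv (chart i) : 'rV[R]_n -> R^o) x =
    ((F \o cinv (chart j)) \o transition (chart i) (chart j)) x.
  by apply: filterS nj => y yj; rewrite /transition /= cmapK.
have [_ E] := near_eq_diff FE (differentiable_cfun F pi).
exact: esym (congr1 (fun h => h w) E).
Qed.

Lemma dcomp_change F i j p : cdom (chart i) p -> cdom (chart j) p ->
  dcomp F i p = dcomp F j p *m (trans_jacobian i j p)^T.
Proof.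
move=> pi pj; apply/rowP => k; rewrite mxE (diff_change F _ pi pj) dcompE.
rewrite -mulmxA -rowE mxE.
by rewrite -[X in _ = (X *m _) _ _]trmxK -trmx_mul [RHS]mxE.
Qed.

Lemma dcomp_smooth F i :
  smooth_on (cimg (chart i)) (dcomp F i \o cinv (chart i)).
Proof.
move=> k; apply: Ck_on_mx; first exact: cimg_open_atlas.
move=> r l; have := (cfun_smooth F i k.+1).2 (delta_mx 0 l).
apply: Ck_on_ext; first exact: cimg_open_atlas.
move=> x; rewrite inE => -[p pi <-].
by rewrite /= mxE cmapK.
Qed.

Lemma bcomp_unit b i p : cdom (chart i) p -> bcomp b i p \in unitmx.
Proof.
move=> pi; rewrite unitmxE unitfE; apply/det0P => -[v /eqP v0 vB]; apply: v0.
by apply: (@b_nondegL _ _ _ b _ _ pi) => w; rewrite /bilin vB mul0mx mxE.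
Qed.

(** Taking determinants in B_i = J B_j J^T, whose left-hand side is
invertible. *)
Lemma trans_jacobian_unit b i j p : cdom (chart i) p -> cdom (chart j) p ->
  trans_jacobian i j p \in unitmx.
Proof.
move=> pi pj; have := bcomp_unit b pi.
by rewrite (bcomp_change b pi pj) !unitmx_mul => /andP[/andP[]].
Qed.

(** The unique solution v of v B w^T = g w^T for all w, where B is the matrix of
b and g the row of dF in chart i. *)
Definition gradL_comp b F i (p : M) : 'rV[R]_n :=
  dcomp F i p *m invmx (bcomp b i p).

(** With v_i = g_i B_i^-1, the laws g_i = g_j J^T and B_i = J B_j J^T turn
v_i B_i = g_i into v_i J B_j J^T = g_j J^T; then J^T and B_j are cancelled. *)
Lemma gradL_comp_change b F i j p : cdom (chart i) p -> cdom (chart j) p ->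
  gradL_comp b F j p = gradL_comp b F i p *m trans_jacobian i j p.
Proof.
move=> pi pj; have uJ := trans_jacobian_unit b pi pj.
have uJT : (trans_jacobian i j p)^T \in unitmx by rewrite unitmx_tr.
apply: (can_inj (mulmxK (bcomp_unit b pj))); rewrite mulmxKV ?bcomp_unit//.
apply: (can_inj (mulmxK uJT)).
have E : gradL_comp b F i p *m bcomp b i p = dcomp F i p.
  by rewrite mulmxKV ?bcomp_unit.
by rewrite -(dcomp_change F pi pj) -E (bcomp_change b pi pj) !mulmxA.
Qed.

Lemma gradL_comp_smooth b F i :
  smooth_on (cimg (chart i)) (gradL_comp b F i \o cinv (chart i)).
Proof.
move=> k; have oU := @cimg_open_atlas i.
apply: (Ck_on_mulmx oU (dcomp_smooth F i k)).
apply: Ck_on_invmx (bcomp_smooth b i k) => //.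
by move=> _ [p pi <-] /=; rewrite cmapK//; exact: bcomp_unit.
Qed.

Lemma gradL_exists b F : exists G, is_gradL b F G.
Proof.
exists (Vfield (@gradL_comp_change b F) (gradL_comp_smooth b F)) => X p.
rewrite /dfun /dfun_in dcompE /beval /bilin /= mulmxKV ?bcomp_unit//; last first.
  exact: chart_atP.
by rewrite -[in LHS](trmxK (dcomp _ _ _)) -trmx_mul mxE.
Qed.

Lemma the_vfieldP (P : vfield M -> Prop) : (exists X, P X) -> P (the_vfield P).
Proof. by rewrite /the_vfield; case: pselect => // h _; case: cid. Qed.

Lemma gradLP b F : is_gradL b F (gradL b F).
Proof. by apply: (@the_vfieldP (is_gradL b F)); exact: gradL_exists. Qed.

(** * The transposed structure and right gradients *)

Lemma bilin_tr (B : 'M[R]_n) v w : bilin B^T v w = bilin B w v.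
Proof.
by rewrite /bilin -[v *m _ *m _]trmxK [LHS]mxE !trmx_mul !trmxK mulmxA.
Qed.

Section Opposite.
Variable b : geom_struct M.

Lemma opp_change i j p : cdom (chart i) p -> cdom (chart j) p ->
  (bcomp b i p)^T =
  trans_jacobian i j p *m (bcomp b j p)^T *m (trans_jacobian i j p)^T.
Proof.
by move=> pi pj; rewrite (bcomp_change b pi pj) !trmx_mul trmxK mulmxA.
Qed.

Lemma opp_smooth i :
  smooth_on (cimg (chart i)) ((fun p => (bcomp b i p)^T) \o cinv (chart i)).
Proof.
move=> k; exact: Ck_on_trmx (@cimg_open_atlas i) _ _ _ _ (bcomp_smooth b i k).
Qed.

Lemma opp_nondegL i p : cdom (chart i) p ->
  forall v, (forall w, bilin (bcomp b i p)^T v w = 0) -> v = 0.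
Proof.
move=> pi v H; apply: (@b_nondegR _ _ _ b _ _ pi) => w.
by rewrite -bilin_tr.
Qed.

Lemma opp_nondegR i p : cdom (chart i) p ->
  forall w, (forall v, bilin (bcomp b i p)^T v w = 0) -> w = 0.
Proof.
move=> pi w H; apply: (@b_nondegL _ _ _ b _ _ pi) => v.
by rewrite -bilin_tr.
Qed.

(** The tensor field (X, Y) |-> b(Y, X). *)
Definition opp_struct : geom_struct M :=
  GeomStruct opp_change opp_smooth opp_nondegL opp_nondegR.

End Opposite.

Lemma is_gradR_opp b F X : is_gradR b F X <-> is_gradL (opp_struct b) F X.
Proof.
have E Y p : beval (opp_struct b) X Y p = beval b Y X p by exact: bilin_tr.
by split=> H Y p; rewrite -(H Y p) E.
Qed.

Lemma gradRP b F : is_gradR b F (gradR b F).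
Proof.
apply: (@the_vfieldP (is_gradR b F)).
have [G GP] := gradL_exists (opp_struct b) F.
by exists G; apply/is_gradR_opp.
Qed.

(** * The bracket and the flows *)

Lemma bracket_gradL b f F p : bracket b f F p = dfun f (gradL b F) p.
Proof. exact: gradLP. Qed.

(** The bracket is defined by left gradients; in its expression by right ones,
b(grad^R F, grad^R f), the second argument can be eliminated. *)
Lemma bracket_gradR b F f p : bracket b F f p = dfun f (gradR b F) p.
Proof.
rewrite /bracket (beval_gradLR p (@gradLP b F) (@gradLP b f) (@gradRP b F)
  (@gradRP b f)).
exact: gradRP.
Qed.

(** By continuity c stays in the domain of one chart i near t, where f o c is
(f o cinv_i) o (cmap_i o c), and the chain rule applies. *)
Lemma integral_at_comp X (c : R -> M) (t : R) (f : cinfty M) :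
  integral_at X c t ->
  is_derive t (1 : R) (f \o c : R -> R^o) (dfun f X (c t)).
Proof.
move=> [cc dc]; set i := chart_at (c t); have ci : cdom (chart i) (c t).
  exact: chart_atP.
have near_ci : \near t, cdom (chart i) (c t).
  by apply: cc; apply: open_nbhs_nbhs; split => //; exact: cdom_open.
have [dx vx] := dc i ci.
have Df := differentiable_cfun f ci.
have Dc : differentiable (cmap (chart i) \o c) t by apply/derivable1_diffP.
have Dfc := differentiable_comp Dc Df.
apply: (@near_eq_is_derive _ _ _
    ((f \o cinv (chart i) : _ -> R^o) \o (cmap (chart i) \o c))).
  by apply: filterS near_ci => s ?; rewrite /= cmapK.
apply: DeriveDef; first exact: diff_derivable.
by rewrite deriveE // diff_comp //= -(deriveE _ Dc) vx.
Qed.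

Lemma flow_derive X (Phi : flow X) (f : cinfty M) t p : fl_dom Phi (t, p) ->
  is_derive t (1 : R) (fun s => pullback (fl_map Phi s) f p)
    (pullback (fl_map Phi t) (dfun f X) p).
Proof. by move=> tp; exact: integral_at_comp (fl_integral tp). Qed.

End Gradients.

Theorem theorem6p1 (R : realType) (n : nat) (M : manifold R n)
  (b : geom_struct M) (F : cinfty M)
  (PhiL : flow (gradL b F)) (PhiR : flow (gradR b F)) (f : cinfty M) :
  (forall (t : R) (p : M), fl_dom PhiL (t, p) ->
     is_derive t (1 : R) (fun s => pullback (fl_map PhiL s) f p)
       (pullback (fl_map PhiL t) (bracket b f F) p)) /\
  (forall (t : R) (p : M), fl_dom PhiR (t, p) ->
     is_derive t (1 : R) (fun s => pullback (fl_map PhiR s) f p)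
       (pullback (fl_map PhiR t) (bracket b F f) p)).
Proof.
split=> t p tp.
  have -> : bracket b f F = dfun f (gradL b F).
    by apply/funext => q; exact: bracket_gradL.
  exact: flow_derive.
have -> : bracket b F f = dfun f (gradR b F).
  by apply/funext => q; exact: bracket_gradR.
exact: flow_derive.
Qed.
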